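(* Let $\operatorname{rank}(A)+1\le l\le N$ and let $\{x^k\}$, $\{\mathcal{I}_k\}$ be generated by the vanilla random block coordinate descent algorithm with batch size $l$ (described in the context) from a feasible $x^0\in\mathcal{X}$. Then there is a constant $v\in(0,1]$ with $v\ge\frac{1}{\binom{N}{l}(N-l+1)}$ such that for all $k\ge 0$ $$\mathbb{E}[q(x^k;\mathcal{I}_k)\mid\mathcal{F}_k]\le v\,q(x^k;\mathcal{N}).$$ Consequently, for any optimal solution $x^*$ of the linear program, $c^T(x^k-x^* )\to 0$ almost surely, and $$\mathbb{E}[c^T(x^k-x^* )]\le(1-v)^k\,\mathbb{E}[c^T(x^0-x^* )]\quad\text{for all }k\ge 0.$$
   Context: Consider the linear program $\min_{x\in\mathbb{R}^N} c^Tx$ subject to $Ax=b$, $x\ge 0$, where $A\in\mathbb{R}^{M\times N}$, $b\in\mathbb{R}^M$, $c\in\mathbb{R}^N$, $M\le N$. It is assumed that the optimal value is finite and attained. Write $\mathcal{N}=\{1,\dots,N\}$ and $\mathcal{X}=\{x\in\mathbb{R}^N: Ax=b,\ x\ge 0\}$. For $x\in\mathcal{X}$ and $\mathcal{I}\subseteq\mathcal{N}$, let $\mathcal{D}(x;\mathcal{I})$ and $q(x;\mathcal{I})$ denote respectively the set of optimal solutions and the optimal value of $$\min_{d\in\mathbb{R}^N}\{c^Td : x+d\ge 0,\ Ad=0,\ d_i=0\ \ \forall i\in\mathcal{N}\setminus\mathcal{I}\}.$$ Vanilla random block coordinate descent: start from $x^0\in\mathcal{X}$. At each iteration $k=0,1,2,\dots$: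 (1) choose $\mathcal{I}_k$ uniformly at random (independently of the past) among the subsets of $\mathcal{N}$ with $|\mathcal{I}_k|=l$; (2) find any $d^k\in\mathcal{D}(x^k;\mathcal{I}_k)$; (3) set $x^{k+1}=x^k+d^k$. Here $\mathcal{F}_k=\{x^0,\dots,x^k\}$ denotes the history of the algorithm. *)

(* Defs.v *)
From HB Require Import structures.
From mathcomp Require Export all_boot all_order all_algebra.
From mathcomp Require Export all_classical all_reals all_analysis.
From mathcomp Require Export measurable_realfun.
Export Order.TTheory GRing.Theory Num.Theory.
Export numFieldNormedType.Exports.

Set Implicit Arguments.
Unset Strict Implicit.
Unset Printing Implicit Defensive.

Local Open Scope classical_set_scope.
Local Open Scope ring_scope.

Definition dotmx (R : realType) (N : nat) (c x : 'cV[R]_N) : R :=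
  (c^T *m x) 0 0.

Definition nonneg_cv (R : realType) (N : nat) (x : 'cV[R]_N) : Prop :=
  forall i, 0 <= x i 0.

Definition minimizers (R : realType) (N : nat) (c : 'cV[R]_N)
    (S : set 'cV[R]_N) : set 'cV[R]_N :=
  [set x | S x /\ forall y, S y -> dotmx c x <= dotmx c y].

(* Extended-real valued, so that no junk value enters when the program is
   infeasible (+oo) or unbounded (-oo). *)
Definition optimal_value (R : realType) (N : nat) (c : 'cV[R]_N)
    (S : set 'cV[R]_N) : \bar R :=
  ereal_inf [set (dotmx c x)%:E | x in S].

Definition feasible (R : realType) (M N : nat) (A : 'M[R]_(M, N))
    (b : 'cV[R]_M) : set 'cV[R]_N :=
  [set x | A *m x = b /\ nonneg_cv x].

Definition feasible_dir (R : realType) (M N : nat) (A : 'M[R]_(M, N))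
    (x : 'cV[R]_N) (I : {set 'I_N}) : set 'cV[R]_N :=
  [set d | [/\ nonneg_cv (x + d), A *m d = 0 &
               forall i, i \notin I -> d i 0 = 0]].

Definition optimal_dir (R : realType) (M N : nat) (A : 'M[R]_(M, N))
    (c x : 'cV[R]_N) (I : {set 'I_N}) : set 'cV[R]_N :=
  minimizers c (feasible_dir A x I).

Definition qval (R : realType) (M N : nat) (A : 'M[R]_(M, N))
    (c x : 'cV[R]_N) (I : {set 'I_N}) : \bar R :=
  optimal_value c (feasible_dir A x I).

(* The sigma-algebra generated by the coordinates of x^0, ..., x^k. *)
Definition history (R : realType) (T : Type) (N : nat)
    (x : nat -> T -> 'cV[R]_N) (k : nat) : set (set T) :=
  <<s [set B | exists j i (S : set R), [/\ (j <= k)%N, measurable S &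
                 B = (fun w => x j w i 0) @^-1` S] ] >>.

(* Y is a version of E[X | F].  For integrable X the second condition forces
   Y to be integrable, so this is the usual definition; it also covers X of
   constant sign (such as X <= 0) without any integrability assumption, in
   which case Y is still unique almost surely. *)
Definition is_cond_expectation d (T : measurableType d) (R : realType)
    (P : probability T R) (F : set (set T)) (X Y : T -> \bar R) : Prop :=
  (forall S : set (\bar R), measurable S -> F (Y @^-1` S)) /\
  (forall B, F B -> (\int[P]_(w in B) Y w = \int[P]_(w in B) X w)%E).

(* A run of the vanilla random block coordinate descent with batch size l.
   The starting point may be random (a constant x 0 being a special case), and
   the choice of the step among the minimizers is arbitrary, possibly using
   extra randomness. *)
Record vanilla_rbcd d (T : measurableType d) (R : realType)
    (P : probability T R) (M N : nat) (A : 'M[R]_(M, N)) (b : 'cV[R]_M)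
    (c : 'cV[R]_N) (l : nat) (x : nat -> T -> 'cV[R]_N)
    (I : nat -> T -> {set 'I_N}) (dir : nat -> T -> 'cV[R]_N) : Prop := {
  rbcd_measurable_x : forall k i, measurable_fun setT (fun w => x k w i 0);
  rbcd_measurable_I : forall k J, measurable (I k @^-1` [set J]);
  rbcd_start : forall w, feasible A b (x 0%N w);
  rbcd_card : forall k w, #|I k w| = l;
  rbcd_uniform : forall k (J : {set 'I_N}), #|J| = l ->
    P (I k @^-1` [set J]) = ('C(N, l)%:R^-1)%:E;
  rbcd_indep : forall k J B, history x k B ->
    P (B `&` I k @^-1` [set J]) = (P B * P (I k @^-1` [set J]))%E;
  rbcd_dir : forall k w, optimal_dir A c (x k w) (I k w) (dir k w);
  rbcd_step : forall k w, x k.+1 w = x k w + dir k w }.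

(* Main.v *)
Require Import Defs.
From mathcomp Require Import ring lra.

Set Implicit Arguments.
Unset Strict Implicit.
Unset Printing Implicit Defensive.

(** The displacement from a feasible [x] to an optimal solution lies in the
    kernel of [A].  It splits conformally (all parts having the signs of the
    whole) into at most [N - l + 1] kernel vectors with at most [l] nonzero
    entries, and each of them is a feasible direction at [x].  One of them
    achieves a fraction [1 / (N - l + 1)] of the total decrease, and its support
    lies in the random block with probability at least [1 / 'C(N, l)].  Since
    the block is independent of the past, the gap to optimality contracts in
    mean by [1 - v] on every event of the history.  As the gap is pointwise
    nonincreasing, almost sure convergence follows on each event where the
    initial gap is bounded, without integrability of the starting point. *)

Local Open Scope classical_set_scope.
Local Open Scope ring_scope.

(** * Conformal decompositions *)

Definition supp (R : realType) (N : nat) (d : 'cV[R]_N) : {set 'I_N} :=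
  [set i | d i 0 != 0]%SET.

Lemma suppP (R : realType) (N : nat) (d : 'cV[R]_N) i :
  reflect (d i 0 = 0) (i \notin supp d).
Proof. by rewrite inE negbK; exact: eqP. Qed.

(** Dimension count: the vectors supported on [S] form a space of dimension [#|S|], and [A]
    restricted to it has rank at most [\rank A]. *)
Lemma exists_kernel_supp (R : realType) (M N : nat) (A : 'M[R]_(M, N))
    (S : {set 'I_N}) : (\rank A < #|S|)%N ->
  exists u : 'cV[R]_N, [/\ u != 0, A *m u = 0 & supp u \subset S].
Proof.
(* The rows of [E] are the unit vectors indexed by [S], so [w *m E] spreads the entries of [w] over
   [S] and is zero elsewhere. *)
move=> hS; pose E : 'M[R]_(#|S|, N) := \matrix_(i, j) (enum_val i == j)%:R.
have Ee (w : 'rV_#|S|) i : (w *m E) 0 (enum_val i) = w 0 i.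
  rewrite mxE (bigD1 i) //= mxE eqxx mulr1 big1 ?addr0 // => j ji.
  by rewrite mxE (inj_eq enum_val_inj) (negbTE ji) mulr0.
have : kermx (E *m A^T) != 0.
  rewrite -mxrank_eq0 mxrank_ker -lt0n subn_gt0.
  by apply: leq_ltn_trans hS; rewrite -[leqRHS]mxrank_tr mxrankM_maxr.
case/rowV0Pn => w /sub_kermxP wE w0; exists (w *m E)^T; split.
- apply: contra w0 => /eqP e; apply/eqP/rowP => i.
  by rewrite -Ee -[w *m E]trmxK e !mxE.
- by apply: trmx_inj; rewrite trmx_mul trmxK trmx0 -mulmxA.
- apply/fintype.subsetP => j; apply: contraLR => jS; apply/suppP.
  rewrite !mxE big1 // => i _; rewrite mxE; case: eqP => [e|]; last by rewrite mulr0.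
  by rewrite -e enum_valP in jS.
Qed.

(** Ratio test as in the simplex method: [a] is the smallest ratio [d i 0 / u i 0] over the entries
    where [u] and [d] share a sign. No entry changes sign, and an entry attaining the minimum
    vanishes. *)
Lemma conformal_reduction (R : realType) (N : nat) (d u : 'cV[R]_N) :
  supp u \subset supp d -> (exists i, 0 < u i 0 * d i 0) ->
  exists a : R, [/\ 0 < a, forall i, 0 <= (d - a *: u) i 0 * d i 0 &
                supp (d - a *: u) \proper supp d].
Proof.
move=> /fintype.subsetP sud [i0 i0P].
have [i iP imin] := @Order.TotalTheory.arg_minP _ _ _ i0 (fun i => 0 < u i 0 * d i 0)
  (fun i => d i 0 / u i 0) i0P.
have di0 : d i 0 != 0 by apply: contraTneq iP => ->; rewrite mulr0 ltxx.
have ui0 : u i 0 != 0 by apply: contraTneq iP => ->; rewrite mul0r ltxx.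
have a0 : 0 < d i 0 / u i 0.
  rewrite (_ : _ / _ = (u i 0 * d i 0) / (u i 0 ^+ 2)); last by field.
  by rewrite divr_gt0 // exprn_even_gt0.
exists (d i 0 / u i 0); split => // [j|].
  (* Where the signs do not agree, subtracting [a *: u] cannot bring the entry closer to 0;
     elsewhere minimality of the ratio applies. *)
  rewrite !mxE; have [ujd|ujd] := ltP 0 (u j 0 * d j 0); last by nra.
  have uj0 : u j 0 != 0 by apply: contraTneq ujd => ->; rewrite mul0r ltxx.
  rewrite mulrBl subr_ge0.
  have -> : d j 0 * d j 0 = d j 0 / u j 0 * (u j 0 * d j 0) by field.
  by rewrite -(mulrA (d i 0 / u i 0)) ler_wpM2r ?(ltW ujd) // imin.
apply/properP; split; last first.
  exists i; first by rewrite inE.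
  by apply/suppP; rewrite !mxE; field.
apply/fintype.subsetP => j; apply: contraLR => jd; apply/suppP; rewrite !mxE.
rewrite (suppP _ _ jd) (suppP u j _) ?mulr0 ?subr0 //.
by apply: contra jd => /sud.
Qed.

Lemma supp_eq0 (R : realType) (N : nat) (d : 'cV[R]_N) : (supp d == finset.set0) = (d == 0).
Proof.
apply/eqP/eqP => [e|->]; last by apply/setP => i; rewrite !inE mxE eqxx.
by apply/colP => i; rewrite mxE; apply/suppP; rewrite e inE.
Qed.

(** Induction on the size of the support: as long as it exceeds [\rank A + 1], some kernel vector
    lives on a proper part of it, and the ratio test yields a kernel vector conformal to [d] with
    smaller support. *)
Lemma conformal_elementary (R : realType) (M N : nat) (A : 'M[R]_(M, N))
    (d : 'cV[R]_N) : d != 0 -> A *m d = 0 ->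
  exists z : 'cV[R]_N, [/\ z != 0, A *m z = 0, supp z \subset supp d,
    forall i, 0 <= z i 0 * d i 0 & (#|supp z| <= \rank A + 1)%N].
Proof.
have [n] := ubnP #|supp d|; elim: n => // n IH in d *; rewrite ltnS => dn d0 Ad.
have [small|big] := leqP #|supp d| (\rank A + 1)%N.
  by exists d; split => // i; rewrite -expr2 sqr_ge0.
(* The index [i] is kept out of the support of [u], so that [d - a *: u] retains its entry at [i]
   and is not zero. *)
have [i id] : exists i, i \in supp d by apply/set0Pn; rewrite supp_eq0.
have [|u0 [u0n Au0 su0]] := @exists_kernel_supp R M N A (supp d :\ i)%SET.
  by move: big; rewrite addn1 (cardsD1 i) id.
(* Up to a change of sign, the kernel vector agrees in sign with [d] at some index, as the ratio
   test requires. *)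
have [u [Au su [j uj]]] : exists u : 'cV[R]_N,
    [/\ A *m u = 0, supp u \subset (supp d :\ i)%SET &
        exists j, 0 < u j 0 * d j 0].
  have [j ju] : exists j, j \in supp u0 by apply/set0Pn; rewrite supp_eq0.
  have := fintype.subsetP su0 _ ju; rewrite !inE => /andP[_ dj].
  move: (ju); rewrite inE => uj.
  have [pos|neg] := ltP 0 (u0 j 0 * d j 0); first by exists u0; split => //; exists j.
  exists (- u0); split; first by rewrite mulmxN Au0 oppr0.
    suff -> : supp (- u0) = supp u0 by [].
    by apply/setP => k; rewrite !inE mxE oppr_eq0.
  exists j; rewrite mxE mulNr oppr_gt0 lt_neqAle neg andbT.
  by rewrite mulf_neq0.
have sud : supp u \subset supp d by apply: fintype.subset_trans su (subD1set _ _).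
have [a [a0 conf prop]] := conformal_reduction sud (ex_intro _ j uj).
have [|||z [z0 Az sz cz card]] := IH (d - a *: u).
- exact: leq_trans (proper_card prop) dn.
- rewrite -supp_eq0; apply/set0Pn; exists i; move: id; rewrite !inE !mxE.
  rewrite (suppP u i _) ?mulr0 ?subr0 //.
  by apply/negP => /(fintype.subsetP su); rewrite !inE eqxx.
- by rewrite mulmxBr Ad -scalemxAr Au scaler0 subr0.
exists z; split => //; first exact: fintype.subset_trans sz (proper_sub prop).
(* Sign agreement is transitive only through a nonzero middle term: here the entry [e] of
   [d - a *: u], nonzero on the support of [z]. *)
move=> k; have [zk0|zk] := eqVneq (z k 0) 0; first by rewrite zk0 mul0r.
have : k \in supp (d - a *: u) by apply: (fintype.subsetP sz); rewrite inE.
rewrite inE; move: (cz k) (conf k); set e := (d - a *: u) k 0.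
move=> h1 h2 e0; have e2 : 0 < e ^+ 2 by rewrite exprn_even_gt0.
by rewrite -(pmulr_lge0 _ e2); have := mulr_ge0 h1 h2; congr (0 <= _); ring.
Qed.

Lemma dotmxE (R : realType) (N : nat) (c x : 'cV[R]_N) :
  dotmx c x = \sum_i c i 0 * x i 0.
Proof. by rewrite /dotmx mxE; apply: eq_bigr => i _; rewrite mxE. Qed.

Lemma dotmxD (R : realType) (N : nat) (c x y : 'cV[R]_N) :
  dotmx c (x + y) = dotmx c x + dotmx c y.
Proof. by rewrite /dotmx mulmxDr mxE. Qed.

Lemma dotmxN (R : realType) (N : nat) (c x : 'cV[R]_N) :
  dotmx c (- x) = - dotmx c x.
Proof. by rewrite /dotmx mulmxN mxE. Qed.

Lemma dotmxZ (R : realType) (N : nat) (a : R) (c x : 'cV[R]_N) :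
  dotmx c (a *: x) = a * dotmx c x.
Proof. by rewrite /dotmx -scalemxAr mxE. Qed.

Lemma dotmx0 (R : realType) (N : nat) (c : 'cV[R]_N) : dotmx c 0 = 0.
Proof. by rewrite /dotmx mulmx0 mxE. Qed.

Lemma card_superset (T : finType) (S : {set T}) (l : nat) :
  (#|S| <= l <= #|T|)%N -> exists J : {set T}, S \subset J /\ #|J| = l.
Proof.
case/andP => Sl lT; elim: l Sl lT => [|l IH].
  by rewrite leqn0 => /eqP S0 _; exists S.
rewrite leq_eqVlt => /predU1P[<- _|]; first by exists S.
rewrite ltnS => Sl lT; have [J [SJ Jl]] := IH Sl (ltnW lT).
have [i iJ] : exists i, i \notin J.
  suff [i] : exists i, i \in (~: J)%SET by rewrite inE => h; exists i.
  by apply/card_gt0P; rewrite cardsCs finset.setCK Jl subn_gt0.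
exists (i |: J)%SET; split; last by rewrite cardsU1 iJ Jl.
by apply: fintype.subset_trans SJ (finset.subsetUr _ _).
Qed.

(* Splitting [d = a z + e] into two conformal parts, [a z] with a small
   support, either [a z] or, by induction on [n], [e] provides the step. *)
Lemma exists_block_direction (R : realType) (M N : nat) (A : 'M[R]_(M, N))
    (c x d : 'cV[R]_N) (l n : nat) :
  (\rank A + 1 <= l <= N)%N -> nonneg_cv x ->
  nonneg_cv (x + d) -> A *m d = 0 -> (#|supp d| <= l + n)%N ->
  exists (J : {set 'I_N}) (z : 'cV[R]_N),
    [/\ #|J| = l, feasible_dir A x J z & n.+1%:R * dotmx c z <= dotmx c d].
Proof.
move=> /andP[rl lN] x0.
have extend (z : 'cV[R]_N) : nonneg_cv (x + z) -> A *m z = 0 ->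
    (#|supp z| <= l)%N -> exists J : {set 'I_N}, #|J| = l /\ feasible_dir A x J z.
  move=> xz Az zl; have [|J [sJ Jl]] := @card_superset _ (supp z) l.
    by rewrite zl card_ord.
  exists J; split => //; split => // i iJ; apply/suppP.
  by apply: contra iJ; apply/fintype.subsetP.
elim: n d => [|n IH] d xd Ad dl.
  rewrite addn0 in dl; have [J [Jl fJ]] := extend _ xd Ad dl.
  by exists J, d; split => //; rewrite mul1r.
have [d0|dn0] := eqVneq d 0.
  have [||J [Jl fJ]] := extend 0 _ (mulmx0 _ _).
  - by rewrite addr0.
  - by have -> : supp (0 : 'cV[R]_N) = finset.set0; [apply/eqP; rewrite supp_eq0|rewrite cards0].
  by exists J, 0; split => //; rewrite d0 dotmx0 mulr0.
have [z [z0 Az sz cz zl]] := conformal_elementary dn0 Ad.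
have [|a [a0 ce pe]] := conformal_reduction sz.
  have [j jz] : exists j, j \in supp z by apply/set0Pn; rewrite supp_eq0.
  have := fintype.subsetP sz _ jz; move: jz; rewrite !inE => jz jd.
  by exists j; rewrite lt_neqAle cz eq_sym mulf_neq0.
have zd i : d i 0 = 0 -> z i 0 = 0.
  by move=> /suppP di; apply/suppP; apply: contra di; apply/fintype.subsetP.
(* A conformal part [s] of [d i 0] leads to a point between [x i 0] and [x i 0 + d i 0], both
   nonnegative. *)
have conf (i : 'I_N) (s t : R) : 0 <= s * d i 0 -> 0 <= t * d i 0 ->
    (d i 0 = 0 -> s = 0) -> s + t = d i 0 -> 0 <= x i 0 + s.
  move=> hs ht d0 st; have := xd i; have := x0 i; rewrite mxE.
  have [dneg|dpos|/d0 ->] := ltgtP (d i 0) 0; last by rewrite addr0.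
    by rewrite nmulr_lge0 // in ht; lra.
  by rewrite pmulr_lge0 // in hs; lra.
have xe : nonneg_cv (x + (d - a *: z)).
  move=> i; rewrite mxE; apply: (conf i _ (a * z i 0)) => //.
  - by rewrite -mulrA mulr_ge0 // ltW.
  - by move=> di; rewrite !mxE di zd // mulr0 subr0.
  - by rewrite !mxE; ring.
have xz : nonneg_cv (x + a *: z).
  move=> i; rewrite mxE; apply: (conf i _ ((d - a *: z) i 0)) => //.
  - by rewrite mxE -mulrA mulr_ge0 // ltW.
  - by move=> /zd di; rewrite mxE di mulr0.
  - by rewrite !mxE; ring.
(* If [a *: z] misses the share [1 / (n + 2)] of the decrease, the rest carries more than
   [(n + 1) / (n + 2)] of it, and the induction hypothesis extracts a fraction [1 / (n + 1)] of
   that. *)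
have [small|large] := leP (n.+2%:R * dotmx c (a *: z)) (dotmx c d).
  have [|||J [Jl fJ]] := extend (a *: z) => //.
  - by rewrite -scalemxAr Az scaler0.
  - apply: leq_trans (leq_trans zl rl); apply: subset_leq_card.
    apply/fintype.subsetP => i; rewrite !inE !mxE mulf_eq0 negb_or.
    by case/andP.
  by exists J, (a *: z).
have [|||J [w [Jl fw cw]]] := IH (d - a *: z) => //.
- by rewrite mulmxBr Ad -scalemxAr Az scaler0 subr0.
- by have := leq_trans (proper_card pe) dl; rewrite addnS ltnS.
exists J, w; split => //.
rewrite dotmxD dotmxN in cw; move: large cw; rewrite -!natr1.
have := ler0n R n.
set q := n%:R : R; set W := dotmx c w; set D := dotmx c d.
set Z := dotmx c (a *: z) => q0 h1 h2.
have h3 : (q + 1 + 1) * ((q + 1) * W) <= (q + 1 + 1) * (D - Z).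
  by rewrite ler_wpM2l // addr_ge0 // addr_ge0.
have h4 : (q + 1) * ((q + 1 + 1) * W) <= (q + 1) * D by lra.
by rewrite ler_pM2l // in h4; lra.
Qed.

(** * Values of the restricted linear programs *)

(** Lets a strict bound on the cost of a direction survive scaling by a factor below 1. *)
Lemma exists_shrink (R : realType) (u t : R) : u < t -> exists s : R, [/\ 0 < s, s < 1 & s * u < t].
Proof.
move=> ut; have [u0|u0] := leP 0 u; first by exists (2^-1); split; lra.
have [t0|t0] := leP 0 t; first by exists (2^-1); split; lra.
have tu : t / u < 1 by rewrite ltr_ndivrMr // mul1r.
have tu0 : 0 < t / u by rewrite nmulr_rgt0 // invr_lt0.
(* Since [u] is negative, any factor strictly between [t / u] and 1 will do; this is the
   midpoint. *)
exists ((t / u + 1) / 2); split; [by lra|by lra|].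
by rewrite -ltr_ndivrMr //; lra.
Qed.

Section lp_value.
Context (R : realType) (M N : nat) (A : 'M[R]_(M, N)) (b : 'cV[R]_M) (c : 'cV[R]_N).
Implicit Types (x y xs d : 'cV[R]_N) (J : {set 'I_N}).

Lemma qval_le x J d : feasible_dir A x J d -> (qval A c x J <= (dotmx c d)%:E)%E.
Proof. by move=> fd; apply: ereal_inf_lbound; exists d. Qed.

Lemma qval_le0 x J : nonneg_cv x -> (qval A c x J <= 0)%E.
Proof.
move=> x0; rewrite -[leRHS]/(0%R%:E) -(dotmx0 c); apply: qval_le.
by split => [||i _]; rewrite ?addr0 ?mulmx0 ?mxE.
Qed.

Lemma qval_optimal_dir x J d : optimal_dir A c x J d -> qval A c x J = (dotmx c d)%:E.
Proof.
case=> fd od; apply/eqP; rewrite eq_le qval_le //=.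
by apply: le_ereal_inf_tmp => _ [y fy <-]; rewrite lee_fin; exact: od.
Qed.

Lemma feasibleD x J d : feasible A b x -> feasible_dir A x J d -> feasible A b (x + d).
Proof. by move=> [Ax _] [xd Ad _]; split => //; rewrite mulmxDr Ad addr0. Qed.

Lemma qval_ge x J xs : feasible A b x -> minimizers c (feasible A b) xs ->
  ((dotmx c (xs - x))%:E <= qval A c x J)%E.
Proof.
move=> fx [_ oxs]; apply: le_ereal_inf_tmp => _ [y fy <-].
have := oxs _ (feasibleD fx fy); rewrite lee_fin !dotmxD dotmxN.
by rewrite lerBlDl.
Qed.

Lemma feasible_dirB x xs : feasible A b x -> feasible A b xs ->
  feasible_dir A x [set: 'I_N]%SET (xs - x).
Proof.
move=> [Ax _] [Axs xs0]; split => [||i]; rewrite ?inE //.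
  by rewrite addrC subrK.
by rewrite mulmxBr Ax Axs subrr.
Qed.

Lemma qval_fin_num x J xs : feasible A b x -> minimizers c (feasible A b) xs ->
  qval A c x J \is a fin_num.
Proof.
move=> fx oxs; rewrite fin_numElt (lt_le_trans _ (qval_ge J fx oxs)) ?ltNyr //=.
by rewrite (le_lt_trans (qval_le0 _ _)) ?ltry //; case: fx.
Qed.

Lemma qval_setT x xs : feasible A b x -> minimizers c (feasible A b) xs ->
  qval A c x [set: 'I_N]%SET = (dotmx c (xs - x))%:E.
Proof.
move=> fx oxs; apply/eqP; rewrite eq_le qval_ge //= andbT.
exact/qval_le/feasible_dirB/oxs.1.
Qed.

(** One good block suffices, because the values of all other blocks are at most 0. The support of
    [xs - x] has at most [N = l + (N - l)] elements, whence the factor [N - l + 1]. *)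
Lemma sum_qval_le x xs l : (\rank A + 1 <= l <= N)%N ->
  feasible A b x -> minimizers c (feasible A b) xs ->
  (\sum_(J : {set 'I_N} | #|J| == l) qval A c x J <=
   ((N - l + 1)%:R^-1 * dotmx c (xs - x))%:E)%E.
Proof.
move=> hl fx oxs; have [Ax x0] := fx; have [[Axs xs0] _] := oxs.
have [||| J [z [Jl fz cz]]] := @exists_block_direction R M N A c x (xs - x) l (N - l) hl x0.
- by rewrite addrC subrK.
- by rewrite mulmxBr Ax Axs subrr.
- by rewrite subnKC; [rewrite -[leqRHS]card_ord max_card | case/andP: hl].
rewrite (bigD1 J) /=; last by rewrite Jl.
apply: (@le_trans _ _ (qval A c x J)).
  by apply: geeDl; apply: sume_le0 => K _; exact: qval_le0.
apply: le_trans (qval_le fz) _; rewrite lee_fin ler_pdivlMl ?ltr0n ?addn1 //.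
Qed.

Lemma feasible_dir_le x y J d : (forall i, x i 0 <= y i 0) ->
  feasible_dir A x J d -> feasible_dir A y J d.
Proof.
move=> xy [xd Ad dJ]; split => // i; apply: le_trans (xd i) _.
by rewrite !mxE lerD2r.
Qed.

Lemma feasible_dirZ x J d (s : R) : 0 <= s ->
  feasible_dir A x J d -> feasible_dir A (s *: x) J (s *: d).
Proof.
move=> s0 [xd Ad dJ]; split => [i||i iJ].
- by rewrite -scalerDr mxE mulr_ge0.
- by rewrite -scalemxAr Ad scaler0.
- by rewrite mxE dJ // mulr0.
Qed.

(* Shrinking a feasible direction makes room for replacing [x] by a rational
   point below it, so that the sublevel set is a countable union of orthants. *)
Lemma qval_lt_rat x J (t : R) : nonneg_cv x ->
  (qval A c x J < t%:E)%E <->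
  exists2 r : 'cV[rat]_N,
    (exists2 d, feasible_dir A (map_mx ratr r) J d & dotmx c d < t) &
    forall i, ratr (r i 0) <= x i 0.
Proof.
move=> x0; split; last first.
  move=> [r [d fd dt] rx]; apply: (@le_lt_trans _ _ (dotmx c d)%:E).
    by apply: qval_le; apply: feasible_dir_le fd => i; rewrite mxE.
  by rewrite lte_fin.
move=> /ereal_inf_lt[_ [d fd <-]]; rewrite lte_fin => dt.
have [s [s0 s1 sdt]] := exists_shrink dt.
(* Density of the rationals applies when [x i 0] is positive; at 0 both bounds coincide and [q = 0]
   is forced. *)
have /choice[r rP] : forall i : 'I_N, exists q : rat, s * x i 0 <= ratr q <= x i 0.
  move=> i; have := x0 i; rewrite le_eqVlt => /predU1P[<-|xi].
    by exists 0; rewrite rmorph0 mulr0 lexx.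
  have [|q] := @rat_in_itvoo R (s * x i 0) (x i 0).
    by rewrite gtr_pMl.
  by rewrite in_itv => /andP[h1 h2]; exists q; rewrite !ltW.
exists (\col_i r i); last by move=> i; rewrite mxE; case/andP: (rP i).
exists (s *: d); last by rewrite dotmxZ.
apply: feasible_dir_le (feasible_dirZ (ltW s0) fd) => i.
by rewrite !mxE; case/andP: (rP i).
Qed.

Lemma measurable_qval disp (T : measurableType disp) (x : T -> 'cV[R]_N) J :
  (forall i, measurable_fun setT (fun w => x w i 0)) ->
  (forall w, nonneg_cv (x w)) ->
  measurable_fun setT (fun w => qval A c (x w) J).
Proof.
move=> mx x0; apply: (measurability _ (ErealGenInftyO.measurableE R)) => //.
move=> _ [_ [t ->] <-]; rewrite setTI.
rewrite (_ : _ @^-1` _ = \bigcup_(r in setT)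
   [set w | (exists2 d, feasible_dir A (map_mx ratr (r : 'cV[rat]_N)) J d & dotmx c d < t)
     /\ forall i, ratr (r i 0) <= x w i 0]); last first.
  apply/seteqP; split => w /=; rewrite in_itv /=.
    by move=> /(qval_lt_rat _ _ (x0 w))[r h1 h2]; exists r.
  by move=> [r _ [h1 h2]]; apply/(qval_lt_rat _ _ (x0 w)); exists r.
(* For a fixed [r] the condition on directions no longer involves [w], leaving either the empty set
   or the preimage of an orthant. *)
apply: countable_bigcupT_measurable => // r.
have [rd|rd] := pselect (exists2 d, feasible_dir A (map_mx ratr r) J d & dotmx c d < t);
  last first.
  by rewrite (_ : mkset _ = set0) //; apply/seteqP; split => // w [].
rewrite (_ : mkset _ = \bigcap_(i in setT) [set w | ratr (r i 0) <= x w i 0]); last first.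
  by apply/seteqP; split => [w [_ h] i _|w h]; [exact: h|split => // i; exact: h].
apply: fin_bigcap_measurable => // i _.
rewrite (_ : mkset _ = (fun w => x w i 0) @^-1` `[ratr (r i 0), +oo[%classic).
  by rewrite -[X in measurable X]setTI; exact: mx.
by apply/seteqP; split => w /=; rewrite in_itv /= andbT.
Qed.

End lp_value.

(** * Integration over an independent finite choice *)

Section independent_choice.
Local Open Scope ereal_scope.

(** Turns integrals over a subset into integrals over the whole space, where image measures can be
    compared. *)
Lemma ge0_integral_mrestr d (T : measurableType d) (R : realType)
    (mu : measure T R) (D : set T) (mD : measurable D) (g : T -> \bar R) :
  measurable_fun setT g -> (forall w, 0 <= g w) ->
  \int[mrestr mu mD]_w g w = \int[mu]_(w in D) g w.
Proof.
move=> mg g0; rewrite (@ge0_negligible_integral _ _ _ _ setT (~` D)) //=; last 2 first.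
- exact: measurableC.
- by rewrite /mrestr setICl measure0.
rewrite setTD setCK; apply: eq_measure_integral => X mX XD.
by rewrite /= /mrestr setIidl.
Qed.

(* Only the law of [g] matters: the laws of [g] under [mu] restricted to
   [B `&` E] and to [B] are proportional. *)
Lemma ge0_integral_setI_indep d (T : measurableType d) (R : realType)
    (mu : measure T R) (B E : set T) (p : {nonneg R}) (g : T -> \bar R) :
  measurable B -> measurable E -> measurable_fun setT g -> (forall w, 0 <= g w) ->
  (forall S, measurable S ->
    mu (B `&` g @^-1` S `&` E) = p%:num%:E * mu (B `&` g @^-1` S)) ->
  \int[mu]_(w in B `&` E) g w = p%:num%:E * \int[mu]_(w in B) g w.
Proof.
move=> mB mE mg g0 indep.
have mBE := measurableI _ _ mB mE.
(* The absolute value makes the integrand nonnegative on all of [\bar R], and changes nothing on the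
   values of [g]. *)
have law (m : measure T R) : \int[m]_w g w = \int[pushforward m g]_y `|y|.
  rewrite [RHS]ge0_integral_pushforward // preimage_setT.
  by apply: eq_integral => w _ /=; rewrite gee0_abs.
rewrite -(ge0_integral_mrestr mu mBE) // -(ge0_integral_mrestr mu mB) //.
rewrite -ge0_integral_mscale // !law.
apply: eq_measure_integral => S mS _.
rewrite /= /pushforward /= /mscale /= /mrestr [in RHS]setIC -indep //.
by rewrite setIA [_ `&` B]setIC.
Qed.

(** Integrability of [f] is derived: [g < f] controls its negative part, and the inequality between
    integrals its positive part. Then [f \- g] is positive on [B] with zero integral. *)
Lemma null_of_integral_le d (T : measurableType d) (R : realType)
    (mu : measure T R) (B : set T) (f g : T -> \bar R) :
  measurable B -> measurable_fun B f -> mu.-integrable B g ->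
  (forall w, B w -> g w < f w) ->
  \int[mu]_(w in B) f w <= \int[mu]_(w in B) g w -> mu B = 0.
Proof.
move=> mB mf ig gf le_fg.
have mg := measurable_int _ ig.
have fneg : \int[mu]_(w in B) f^\- w < +oo.
  apply: le_lt_trans (integral_funeneg_lt_pinfty mB ig).
  apply: ge0_le_integral => //; [exact: measurable_funeneg|exact: measurable_funeneg|].
  move=> w Bw; rewrite !funenegE ge_max !le_max lexx orbT andbT.
  by rewrite leeN2 (ltW (gf _ Bw)).
have gfin := integrable_fin_num mB ig.
have fpos : \int[mu]_(w in B) f^\+ w < +oo.
  rewrite ltey; apply/eqP => foo; move: le_fg; rewrite integralE foo.
  rewrite addye; last by rewrite -ltNye lteNr.
  by rewrite leye_eq => /eqP e; rewrite e in gfin.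
have i_f : mu.-integrable B f.
  apply/integrableP; split => //.
  under eq_integral do rewrite -/((abse \o f) _) fune_abse.
  rewrite ge0_integralD //; first by rewrite lte_add_pinfty.
  - exact: measurable_funepos.
  - exact: measurable_funeneg.
have h0 : \int[mu]_(w in B) (f \- g) w = 0.
  apply/eqP; rewrite eq_le integralB // sube_le0 le_fg /= -integralB //.
  by apply: integral_ge0 => w Bw; rewrite ltW // sube_gt0 gf.

have i_fg := integrableB mB i_f ig.
have /ae_eq_integral_abs : \int[mu]_(w in B) `|(f \- g) w| = 0.
  rewrite -h0; apply: eq_integral => w /[!inE] Bw.
  by rewrite gee0_abs //= ltW // sube_gt0 gf.
move=> /(_ mB (measurable_int _ i_fg)) ae0.
apply: measure_negligible => //; apply: negligibleS ae0 => w Bw /= /(_ Bw) /= e.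
by have := gf _ Bw; rewrite -sube_gt0 e ltxx.
Qed.

Lemma g_sigma_measurable_fun d d' (T : measurableType d) (U : measurableType d')
    (G : set (set T)) (f : T -> U) :
  (forall B, <<s G >> B -> measurable B) ->
  measurable_fun (setT : set (g_sigma_algebraType G)) f -> measurable_fun setT f.
Proof.
move=> Gm mf _ S mS; rewrite setTI; apply: Gm.
by have := mf measurableT S mS; rewrite setTI.
Qed.

Lemma measurable_fun_fin_choice d d' (T : measurableType d) (U : measurableType d')
    (I : finType) (ch : T -> I) (h : I -> T -> U) :
  (forall J, measurable (ch @^-1` [set J])) ->
  (forall J, measurable_fun setT (h J)) ->
  measurable_fun setT (fun w => h (ch w) w).
Proof.
move=> mch mh _ S mS; rewrite setTI.
rewrite (_ : _ @^-1` _ = \bigcup_(J in setT) (ch @^-1` [set J] `&` h J @^-1` S)).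
  apply: fin_bigcup_measurable => // J _; apply: measurableI => //.
  by rewrite -[X in measurable X]setTI; exact: mh.
by apply/seteqP; split => [w Sw|w [J _ [/= ->]]] //; exists (ch w).
Qed.

(** Cutting [B] along the values of [ch] freezes the choice: on each piece the integrand is some
    [h J], which depends on [G] only and is thus independent of the event that [J] is chosen. *)
Lemma ge0_integral_uniform_choice d (T : measurableType d) (R : realType)
    (mu : measure T R) (G : set (set T)) (I : finType) (ch : T -> I) (S : {set I})
    (p : {nonneg R}) (h : I -> T -> \bar R) (B : set T) :
  (forall C, <<s G >> C -> measurable C) ->
  (forall J, measurable (ch @^-1` [set J])) ->
  (forall w, ch w \in S) ->
  (forall C J, <<s G >> C -> J \in S ->
    mu (C `&` ch @^-1` [set J]) = p%:num%:E * mu C) ->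
  (forall J, measurable_fun (setT : set (g_sigma_algebraType G)) (h J)) ->
  (forall J w, 0 <= h J w) -> <<s G >> B ->
  \int[mu]_(w in B) h (ch w) w =
  \int[mu]_(w in B) (p%:num%:E * \sum_(J in S) h J w).
Proof.
move=> Gm mch chS indep mh h0 GB.
have mB := Gm _ GB.
have mhT J : measurable_fun setT (h J) by exact: g_sigma_measurable_fun (mh J).
have sumE : (fun w => \sum_(J in S) h J w) = (fun w => \sum_(J <- enum S) h J w).
  by apply/funext => w; rewrite big_enum.
have BE : B = \big[setU/set0]_(J <- enum S) (B `&` ch @^-1` [set J]).
  rewrite -bigcup_seq; apply/seteqP; split => [w Bw|w [J _ []]] //.
  by exists (ch w) => //=; rewrite mem_enum.
rewrite [in LHS]BE ge0_integral_bigsetU //=; last 4 first.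
- by move=> J; exact: measurableI.
- exact: enum_uniq.
- by move=> J K _ _ [w [[_ <-] [_ <-]]].
- by apply: measurable_funTS; exact: measurable_fun_fin_choice.
rewrite big_enum /= ge0_integralZl //; last 2 first.
- by rewrite sumE; apply: emeasurable_sum => J; exact: measurable_funTS.
- by move=> w _; exact: sume_ge0.
rewrite sumE.
rewrite ge0_integral_sum //; last by move=> J; exact: measurable_funTS.
rewrite big_enum /= ge0_sume_distrr; last by move=> J _; exact: integral_ge0.
apply: eq_bigr => J JS; rewrite -(@ge0_integral_setI_indep _ _ _ _ _ (ch @^-1` [set J])) //.
  by apply: eq_integral => w /[!inE] -[_ ->].
(* Independence is applied to the trace on [B] of a level event of [h J], which again belongs to the
   sigma-algebra generated by [G]. *)
move=> X mX; apply: indep => //.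
apply: (@measurableI _ (g_sigma_algebraType G)) => //.
by rewrite -[X in measurable X]setTI; exact: mh.
Qed.

End independent_choice.

(** * Random block coordinate descent *)

(** The generators of [history], named so that the history becomes a measurable type and
    measurability with respect to it can be stated by [measurable_fun]. *)
Definition history_gen (R : realType) (T : Type) (N : nat)
    (x : nat -> T -> 'cV[R]_N) (k : nat) : set (set T) :=
  [set B | exists j i (S : set R), [/\ (j <= k)%N, measurable S &
     B = (fun w => x j w i 0) @^-1` S] ].

Section rbcd.
Context (R : realType) (M N : nat) (A : 'M[R]_(M, N))
    (b : 'cV[R]_M) (c : 'cV[R]_N) (l : nat)
    (hl : (\rank A + 1 <= l <= N)%N)
    (d : measure_display) (T : measurableType d) (P : probability T R)
    (x : nat -> T -> 'cV[R]_N) (I : nat -> T -> {set 'I_N})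
    (dir : nat -> T -> 'cV[R]_N)
    (halg : vanilla_rbcd P A b c l x I dir).

Local Notation hist k := (g_sigma_algebraType (history_gen x k)).

Lemma history_measurable k B : history x k B -> measurable B.
Proof.
apply: smallest_sub; first exact: sigma_algebra_measurable.
move=> _ [j [i [S [_ mS ->]]]]; rewrite -[X in measurable X]setTI.
exact: (rbcd_measurable_x halg).
Qed.

Lemma history_mono j k : (j <= k)%N -> history x j `<=` history x k.
Proof.
move=> jk; apply: smallest_sub; first exact: smallest_sigma_algebra.
move=> _ [i [n [S [ij mS ->]]]]; apply: sub_sigma_algebra.
by exists i, n, S; split => //; exact: leq_trans jk.
Qed.

Lemma history_coord k i : measurable_fun (setT : set (hist k)) (fun w => x k w i 0).
Proof.
move=> _ S mS; rewrite setTI; apply: sub_sigma_algebra.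
by exists k, i, S.
Qed.

Lemma rbcd_feasible k w : feasible A b (x k w).
Proof.
elim: k => [|k IH]; first exact: (rbcd_start halg).
rewrite (rbcd_step halg); apply: feasibleD IH _.
by case: (rbcd_dir halg k w) => + _; exact.
Qed.

Lemma rbcd_qval k w : qval A c (x k w) (I k w) = (dotmx c (dir k w))%:E.
Proof. exact/qval_optimal_dir/(rbcd_dir halg). Qed.

Lemma history_qval k J :
  measurable_fun (setT : set (hist k)) (fun w => qval A c (x k w) J).
Proof.
apply: (@measurable_qval _ _ _ A c _ (hist k)) => [i|w]; first exact: history_coord.
by have [] := rbcd_feasible k w.
Qed.

Definition batch_rate : R := ('C(N, l) * (N - l + 1))%:R^-1.

Let p : R := 'C(N, l)%:R^-1.

Let S : {set {set 'I_N}} := [set J : {set 'I_N} | #|J| == l]%SET.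

Lemma batch_prob_gt0 : 0 < p.
Proof. by rewrite invr_gt0 ltr0n bin_gt0; case/andP: hl. Qed.

Lemma batch_prob_sum (a : R) : p * \sum_(J in S) a = a.
Proof.
rewrite sumr_const /S card_draws card_ord -mulr_natl mulrA mulVf ?mul1r //.
by rewrite gt_eqF // -invr_gt0 batch_prob_gt0.
Qed.

Lemma batch_rateE : batch_rate = p * (N - l + 1)%:R^-1.
Proof. by rewrite /batch_rate natrM invfM. Qed.

Lemma batch_rate_gt0 : 0 < batch_rate.
Proof. by rewrite batch_rateE mulr_gt0 ?batch_prob_gt0 // invr_gt0 ltr0n addn1. Qed.

Lemma batch_rate_le1 : batch_rate <= 1.
Proof.
rewrite invf_le1 ?ler1n; last by rewrite -invr_gt0 batch_rate_gt0.
by rewrite muln_gt0 addn1 andbT bin_gt0; case/andP: hl.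
Qed.

Lemma integral_batch (k : nat) (h : {set 'I_N} -> T -> \bar R) (B : set T) :
  (forall J, measurable_fun (setT : set (hist k)) (h J)) ->
  (forall J w, 0 <= h J w)%E -> history x k B ->
  (\int[P]_(w in B) h (I k w) w =
   \int[P]_(w in B) (p%:E * \sum_(J in S) h J w))%E.
Proof.
move=> mh h0 hB.
apply: (@ge0_integral_uniform_choice _ _ _ _ (history_gen x k) _ (I k) S
  (NngNum (ltW batch_prob_gt0))) => //=.
- exact: history_measurable.
- exact: (rbcd_measurable_I halg).
- by move=> w; rewrite inE (rbcd_card halg).
- move=> C J hC; rewrite inE => /eqP JS.
  by rewrite (rbcd_indep halg) // (rbcd_uniform halg) // muleC.
Qed.

(** * Contraction and convergence of the optimality gap *)

Section gap.
Variable xs : 'cV[R]_N.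
Hypothesis oxs : minimizers c (feasible A b) xs.

Let gap k w : R := dotmx c (x k w - xs).

Lemma gap_ge0 k w : 0 <= gap k w.
Proof.
by rewrite /gap dotmxD dotmxN subr_ge0; apply: oxs.2; exact: rbcd_feasible.
Qed.

Lemma qval_fineK k w J : ((fine (qval A c (x k w) J))%:E = qval A c (x k w) J)%E.
Proof. by rewrite fineK //; exact: qval_fin_num (rbcd_feasible k w) oxs. Qed.

Lemma qval_setT_gap k w : qval A c (x k w) [set: 'I_N]%SET = (- gap k w)%:E.
Proof.
by rewrite (qval_setT (rbcd_feasible k w) oxs) /gap -dotmxN opprB.
Qed.

(** The left-hand side is the mean value over a uniform block when the iterate is frozen; this is
    the pointwise source of the rate. *)
Lemma sum_qval_gap k w :
  p * \sum_(J in S) fine (qval A c (x k w) J) <= - (batch_rate * gap k w).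
Proof.
have := sum_qval_le hl (rbcd_feasible k w) oxs.
rewrite -(opprB (x k w)) dotmxN -/(gap k w).
rewrite (eq_bigr (fun J => (fine (qval A c (x k w) J))%:E)); last first.
  by move=> J _; rewrite qval_fineK.
rewrite (eq_bigl (mem S)); last by move=> J; rewrite /S /= inE.
rewrite sumEFin lee_fin -(ler_pM2l batch_prob_gt0) => /le_trans; apply.
by rewrite batch_rateE mulrN mulrN mulrA.
Qed.

Lemma gap_step k w : (gap k.+1 w)%:E = ((gap k w)%:E + qval A c (x k w) (I k w))%E.
Proof.
rewrite rbcd_qval /gap (rbcd_step halg) -EFinD; congr (_ %:E).
by rewrite !dotmxD; ring.
Qed.

Lemma gap_decreasing k w : gap k.+1 w <= gap k w.
Proof.
rewrite -lee_fin gap_step geeDl // qval_le0 //.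
by have [] := rbcd_feasible k w.
Qed.

Lemma gap_monotone j k w : (j <= k)%N -> gap k w <= gap j w.
Proof.
move=> /subnKC <-; elim: (k - j)%N => [|n IH]; first by rewrite addn0.
by rewrite addnS; apply: le_trans (gap_decreasing _ _) IH.
Qed.

Lemma history_gap k : measurable_fun (setT : set (hist k)) (gap k).
Proof.
rewrite /gap (_ : (fun w => _) =
  fun w => \sum_(i <- index_enum 'I_N) (c i 0 * (x k w i 0 - xs i 0))); last first.
  by apply/funext => w; rewrite dotmxE; apply: eq_bigr => i _; rewrite !mxE.
apply: measurable_sum => i; apply: measurable_funM => //.
by apply: measurable_funB => //; exact: history_coord.
Qed.

Lemma history_gap_le k (a : R) : history x k [set w | gap k w <= a].
Proof.
rewrite (_ : mkset _ = gap k @^-1` `]-oo, a]%classic).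
  by have := @history_gap k measurableT _ (measurable_itv `]-oo, a]); rewrite setTI.
by apply/seteqP; split => w /=; rewrite in_itv.
Qed.

Lemma measurable_gap k : measurable_fun setT (gap k).
Proof. exact: g_sigma_measurable_fun (@history_measurable k) (@history_gap k). Qed.

Lemma integral_gap_step k (B : set T) : history x k B ->
  (\int[P]_(w in B) (gap k.+1 w)%:E <=
   (1 - batch_rate)%:E * \int[P]_(w in B) (gap k w)%:E)%E.
Proof.
move=> hB; have mB := history_measurable hB.
(* This is the gap after a step in block [J]. It is nonnegative and determined by the history, so
   the random block can be averaged out. *)
pose h J w := ((gap k w)%:E + qval A c (x k w) J)%E.
have h0 J w : (0 <= h J w)%E.
  rewrite /h -leeBlDl // sub0e -EFinN.
  apply: le_trans (qval_ge J (rbcd_feasible k w) oxs).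
  by rewrite -(opprB (x k w)) dotmxN.
have mh J : measurable_fun (setT : set (hist k)) (h J).
  apply: emeasurable_funD; last exact: history_qval.
  by apply/measurable_EFinP; exact: history_gap.
under eq_integral do rewrite gap_step -/(h (I k _) _).
have mgap : measurable_fun B (fun w => (gap k w)%:E).
  by apply/measurable_EFinP/measurable_funTS; exact: measurable_gap.
rewrite integral_batch // -ge0_integralZl_EFin //; last 2 first.
- by move=> w _; rewrite lee_fin gap_ge0.
- by rewrite subr_ge0 batch_rate_le1.
apply: ge0_le_integral => //.
- move=> w _; apply: mule_ge0; first by rewrite lee_fin ltW // batch_prob_gt0.
  exact: sume_ge0.
- apply: measurable_funeM.
  rewrite (_ : (fun w => _) = fun w => \sum_(J <- enum S) h J w)%E; last first.
    by apply/funext => w; rewrite big_enum.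
  apply: emeasurable_sum => J; apply: measurable_funTS.
  exact: g_sigma_measurable_fun (@history_measurable k) (mh J).
- exact: measurable_funeM.
move=> w _; rewrite (eq_bigr (fun J => (gap k w + fine (qval A c (x k w) J))%:E)).
  rewrite sumEFin -!EFinM lee_fin big_split /= mulrDr batch_prob_sum mulrBl mul1r.
  by rewrite lerD2l sum_qval_gap.
by move=> J _; rewrite EFinD qval_fineK.
Qed.

Lemma integral_gap_le k (B : set T) : history x 0 B ->
  (\int[P]_(w in B) (gap k w)%:E <=
   ((1 - batch_rate) ^+ k)%:E * \int[P]_(w in B) (gap 0 w)%:E)%E.
Proof.
move=> hB; elim: k => [|k IH]; first by rewrite expr0 mul1e.
apply: le_trans (integral_gap_step (history_mono (leq0n k) hB)) _.
rewrite exprS EFinM -muleA lee_wpmul2l // lee_fin subr_ge0.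
exact: batch_rate_le1.
Qed.

Lemma gap_expectation k :
  ('E_P[gap k] <= ((1 - batch_rate) ^+ k)%:E * 'E_P[gap 0])%E.
Proof.
rewrite unlock; apply: integral_gap_le.
exact: (@measurableT _ (hist 0)).
Qed.


(** By Markov's inequality and contraction, [P E / (m + 1)] is at most [(1 - batch_rate) ^+ k * n]
    for every [k], which tends to 0. *)
Lemma gap_null (n m : nat) :
  P.-negligible [set w | gap 0 w <= n%:R /\ forall k, m.+1%:R^-1 <= gap k w].
Proof.
pose B := [set w | gap 0 w <= n%:R].
pose E := B `&` \bigcap_k [set w | m.+1%:R^-1 <= gap k w].
have mpre k (J : interval R) : measurable (gap k @^-1` [set` J]).
  by rewrite -[X in measurable X]setTI; exact: measurable_gap.
have hB : history x 0 B := @history_gap_le 0 n%:R.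
have mB := history_measurable hB.
have mE : measurable E.
  apply: measurableI => //; apply: bigcapT_measurable => k.
  rewrite (_ : mkset _ = gap k @^-1` `[m.+1%:R^-1, +oo[%classic) //.
  by apply/seteqP; split => w /=; rewrite in_itv /= andbT.
rewrite (_ : mkset _ = E); last first.
  by apply/seteqP; split => w [h1 h2]; split => // k; [move=> _; exact: h2|exact: (h2 k)].
have mgap k D : measurable D -> measurable_fun D (fun w => (gap k w)%:E).
  by move=> mD; apply/measurable_EFinP/measurable_funTS; exact: measurable_gap.
have gap0 k w : (0 <= (gap k w)%:E)%E by rewrite lee_fin gap_ge0.
have bound k : ((m.+1%:R^-1)%:E * P E <= ((1 - batch_rate) ^+ k * n%:R)%:E)%E.
  rewrite -(integral_cst _ mE).
  apply: (@le_trans _ _ (\int[P]_(w in E) (gap k w)%:E)%E).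
    apply: ge0_le_integral => // [w _||w [_ /(_ k Logic.I)]].
    - by rewrite lee_fin.
    - exact: mgap.
    - by rewrite lee_fin.
  (* [E] involves all times; contraction needs an event of the initial history, hence the
     enlargement to [B]. *)
  apply: (@le_trans _ _ (\int[P]_(w in B) (gap k w)%:E)%E).
    by apply: ge0_subset_integral => //; [exact: mgap|move=> w []].
  apply: le_trans (integral_gap_le _ hB) _.
  rewrite EFinM lee_wpmul2l ?lee_fin ?exprn_ge0 ?subr_ge0 ?batch_rate_le1 //.
  apply: (@le_trans _ _ (\int[P]_(w in B) (cst n%:R%:E) w)%E).
    by apply: ge0_le_integral => //; exact: mgap.
  rewrite integral_cst // -[leRHS]mule1 lee_wpmul2l //.
  exact: probability_le1.
apply/negligibleP => //; apply/eqP; rewrite eq_le measure_ge0 andbT.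
have PE : P E = (fine (P E))%:E by rewrite fineK // fin_num_measure.
change (P E <= 0)%E; rewrite PE lee_fin -(@pmulr_rle0 _ m.+1%:R^-1) ?invr_gt0 ?ltr0n //.
have cv : (1 - batch_rate) ^+ k * n%:R @[k --> \oo] --> (0 * n%:R : R).
  apply: cvgMl; apply: cvg_expr; rewrite ger0_norm ?subr_ge0 ?batch_rate_le1 //.
  by rewrite gtrBl batch_rate_gt0.
rewrite -(mul0r n%:R) -(cvg_lim _ cv) //.
apply: limr_ge; first exact: cvgP cv.
by apply: nearW => k; have := bound k; rewrite PE -EFinM lee_fin.
Qed.

(** Outside a countable union of null events the gap falls below each [1 / (m + 1)] at some time,
    and monotonicity keeps it there. *)
Lemma gap_cvg_ae : {ae P, forall w, gap k w @[k --> \oo] --> (0 : R)}.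
Proof.
have := negligible_bigcup (fun n => negligible_bigcup (gap_null n)).
apply: negligibleS => w; apply: contra_notP => nw.
apply/cvgrPdist_lt => e e0; have [m] := ltr_add_invr e0; rewrite add0r => me.
have [k km] : exists k, gap k w < m.+1%:R^-1.
  apply: contra_notP nw => nk; exists (Num.trunc (gap 0 w)).+1 => //.
  exists m => //; split => [|k]; first by rewrite ltW // truncnS_gt.
  by rewrite leNgt; apply/negP => h; apply: nk; exists k.
exists k => // j /= kj; rewrite sub0r normrN ger0_norm ?gap_ge0 //.
by apply: le_lt_trans (gap_monotone _ kj) _; exact: lt_trans me.
Qed.

(** * Conditional expectation of the restricted optimal value *)

Let loss k J w := (- qval A c (x k w) J)%E.

(** Its opposite is an explicit version of the conditional expectation. The sign is flipped so that
    integration of nonnegative functions applies without integrability. *)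
Let avg_loss k w := (p%:E * \sum_(J in S) loss k J w)%E.

Lemma loss_ge0 k J w : (0 <= loss k J w)%E.
Proof. by rewrite oppe_ge0 qval_le0 //; have [] := rbcd_feasible k w. Qed.

Lemma history_loss k J : measurable_fun (setT : set (hist k)) (loss k J).
Proof. by apply: measurableT_comp => //; exact: history_qval. Qed.

Lemma history_avg_loss k : measurable_fun (setT : set (hist k)) (avg_loss k).
Proof.
apply: measurable_funeM.
rewrite (_ : (fun w => _) = fun w => \sum_(J <- enum S) loss k J w)%E; last first.
  by apply/funext => w; rewrite big_enum.
by apply: emeasurable_sum => J; exact: history_loss.
Qed.

Lemma avg_loss_ge0 k w : (0 <= avg_loss k w)%E.
Proof.
apply: mule_ge0; first by rewrite lee_fin ltW // batch_prob_gt0.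
by apply: sume_ge0 => J _; exact: loss_ge0.
Qed.

Lemma avg_loss_ge k w : ((batch_rate * gap k w)%:E <= avg_loss k w)%E.
Proof.
rewrite /avg_loss (eq_bigr (fun J => (- fine (qval A c (x k w) J))%:E)).
  rewrite sumEFin -EFinM lee_fin sumrN mulrN lerNr.
  exact: sum_qval_gap.
by move=> J _; rewrite EFinN qval_fineK.
Qed.

Lemma integral_qval k (B : set T) : history x k B ->
  (\int[P]_(w in B) qval A c (x k w) (I k w) = - \int[P]_(w in B) avg_loss k w)%E.
Proof.
move=> hB; rewrite -(@integral_batch k) //; last 2 first.
- exact: history_loss.
- exact: loss_ge0.
rewrite -integral_ge0N; last by move=> w _; exact: loss_ge0.
by apply: eq_integral => w _; rewrite /loss oppeK.
Qed.

Lemma is_cond_expectation_avg k :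
  is_cond_expectation P (history x k) (fun w => qval A c (x k w) (I k w))
    (fun w => - avg_loss k w)%E.
Proof.
split => [X mX|B hB]; last first.
  rewrite integral_qval // integral_ge0N // => w _; exact: avg_loss_ge0.
have mN : measurable_fun (setT : set (hist k)) (fun w => - avg_loss k w)%E.
  by apply: measurableT_comp => //; exact: history_avg_loss.
by have := mN measurableT _ mX; rewrite setTI.
Qed.

(* No integrability is assumed, hence the localisation to [gap k <= n], where
   the bound [- batch_rate * gap k] is bounded. *)
Lemma cond_expectation_le k (Y : T -> \bar R) :
  is_cond_expectation P (history x k) (fun w => qval A c (x k w) (I k w)) Y ->
  {ae P, forall w,
     (Y w <= batch_rate%:E * qval A c (x k w) [set: 'I_N]%SET)%E}.
Proof.
move=> [mY intY]; pose W w := (- (batch_rate * gap k w))%:E.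
have hY : measurable_fun (setT : set (hist k)) Y.
  by move=> _ X mX; rewrite setTI; exact: mY.
have hW : measurable_fun (setT : set (hist k)) W.
  apply/measurable_EFinP; apply: measurableT_comp => //.
  by apply: measurable_funM => //; exact: history_gap.
have mYT := g_sigma_measurable_fun (@history_measurable k) hY.
have mWT := g_sigma_measurable_fun (@history_measurable k) hW.
have rg_ge0 w : 0 <= batch_rate * gap k w.
  by rewrite mulr_ge0 ?gap_ge0 // ltW // batch_rate_gt0.
pose B n := [set w | (W w < Y w)%E] `&` [set w | gap k w <= n%:R].
suff B0 n : P.-negligible (B n).
  have := negligible_bigcup B0; apply: negligibleS => w /=.
  rewrite qval_setT_gap -EFinM mulrN => /negP; rewrite -ltNge => WY.
  exists (Num.trunc (gap k w)).+1 => //; split => //=.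
  by rewrite ltW // truncnS_gt.
have hB : history x k (B n).
  apply: (@measurableI _ (hist k)).
    have := @measurable_lte _ (hist k) R _ measurableT _ _ hW hY.
    by rewrite setTI.
  exact: history_gap_le.
have mB := history_measurable hB.
have iW : P.-integrable (B n) W.
  apply: (le_integrable mB _ _ (finite_measure_integrable_cst P (batch_rate * n%:R) mB)).
    exact: measurable_funTS.
  move=> w [_ /= gn]; rewrite /W lee_fin normrN !ger0_norm //.
    by rewrite ler_pM2l // batch_rate_gt0.
  by rewrite mulr_ge0 // ltW // batch_rate_gt0.
apply/negligibleP => //; apply: (@null_of_integral_le _ _ _ _ _ Y W mB _ iW) => [|w []//|].
  exact: measurable_funTS.
(* On the history event [B n], [Y] has the same integral as [- avg_loss], and [avg_loss] dominates
   [batch_rate * gap]; so the integral of [Y] is at most that of [W], although [W < Y] there. *)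
rewrite intY // integral_qval // (_ : W = fun w => (- (batch_rate * gap k w)%:E)%E) //.
rewrite integral_ge0N; last by move=> w _; rewrite lee_fin.
rewrite leeN2; apply: ge0_le_integral => //.
- by move=> w _; rewrite lee_fin.
- apply/measurable_EFinP; apply: measurable_funM => //.
  by apply: measurable_funTS; exact: measurable_gap.
- apply: measurable_funTS.
  exact: g_sigma_measurable_fun (@history_measurable k) (@history_avg_loss k).
- by move=> w _; exact: avg_loss_ge.
Qed.

End gap.
End rbcd.

Theorem mainTheorem2 (R : realType) (M N : nat) (A : 'M[R]_(M, N))
    (b : 'cV[R]_M) (c : 'cV[R]_N) (l : nat)
    (hMN : (M <= N)%N)
    (hopt : exists x, minimizers c (feasible A b) x)
    (hl : (\rank A + 1 <= l <= N)%N)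
    (d : measure_display) (T : measurableType d) (P : probability T R)
    (x : nat -> T -> 'cV[R]_N) (I : nat -> T -> {set 'I_N})
    (dir : nat -> T -> 'cV[R]_N)
    (halg : vanilla_rbcd P A b c l x I dir) :
  exists v : R,
    [/\ 0 < v <= 1,
        ('C(N, l) * (N - l + 1))%:R^-1 <= v,
        (forall k : nat,
          (exists Y : T -> \bar R,
             is_cond_expectation P (history x k)
               (fun w => qval A c (x k w) (I k w)) Y) /\
          (forall Y : T -> \bar R,
             is_cond_expectation P (history x k)
               (fun w => qval A c (x k w) (I k w)) Y ->
             {ae P, forall w,
                (Y w <= v%:E * qval A c (x k w) [set: 'I_N]%SET)%E})) &
        (forall xs : 'cV[R]_N, minimizers c (feasible A b) xs ->
          {ae P, forall w,
             dotmx c (x k w - xs) @[k --> \oo] --> (0 : R)} /\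
          (forall k : nat,
             ('E_P[fun w => dotmx c (x k w - xs)] <=
              ((1 - v) ^+ k)%:E * 'E_P[fun w => dotmx c (x 0%N w - xs)])%E))].
Proof.
(* The constant [v] is the lower bound itself, so the second conjunct holds by reflexivity. *)
have [xs0 oxs0] := hopt; exists (batch_rate R N l); split => //.
- by rewrite (batch_rate_gt0 hl) (batch_rate_le1 hl).
- move=> k; split; first by eexists; exact: (is_cond_expectation_avg hl halg).
  exact: (cond_expectation_le hl halg oxs0).
- move=> xs oxs; split; first exact: (gap_cvg_ae hl halg oxs).
  exact: (gap_expectation hl halg oxs).
Qed.
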